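(* Let $\alpha>0$, $0<p<\infty$, and let $\mu$ be a finite positive Borel measure on $\mathbb{C}$. Then $\mu$ is a $(p,\infty)$ Fock-Carleson measure if and only if $\mu$ is a $(p,q)$ Fock-Carleson measure for every $q\ge1$.
   Context: $F^p_\alpha$ is the space of entire functions $f$ with $\|f\|_{p,\alpha}=\left[\frac{p\alpha}{2\pi}\int_{\mathbb{C}}|f(z)e^{-\alpha|z|^2/2}|^p\,dA(z)\right]^{1/p}<\infty$. For $0<q<\infty$, $\mu$ is a $(p,q)$ Fock-Carleson measure if there is $C>0$ with $\left[\int_{\mathbb{C}}|f(z)e^{-\alpha|z|^2/2}|^q\,d\mu(z)\right]^{1/q}\le C\|f\|_{p,\alpha}$ for all $f\in F^p_\alpha$. $\mu$ is a $(p,\infty)$ Fock-Carleson measure if there is $C>0$ with $\|f\|_{\infty,\mu}\le C\|f\|_{p,\alpha}$ for all $f\in F^p_\alpha$, where $\|f\|_{\infty,\mu}$ is the $\mu$-essential supremum of $|f(z)e^{-\alpha|z|^2/2}|$. *)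

(* Defs.v *)
From HB Require Import structures.
From mathcomp Require Import all_boot all_order all_algebra.
From mathcomp Require Import all_classical all_reals all_analysis.
From mathcomp Require Import ess_sup_inf.
From mathcomp.real_closed Require Import complex.
Set Implicit Arguments. Unset Strict Implicit. Unset Printing Implicit Defensive.
Import Order.TTheory GRing.Theory Num.Theory.
Import numFieldNormedType.Exports.
Local Open Scope classical_set_scope.
Local Open Scope ring_scope.
Local Open Scope complex_scope.

Section Fock.
Variable R : realType.

Definition cplx (z : R * R) : R[i] := z.1 +i* z.2.

Definition entire (f : R[i] -> R[i]) : Prop := forall z : R[i], derivable (f : R[i]^o -> R[i]^o) z 1.

Definition area := (@lebesgue_measure R \x @lebesgue_measure R)%E.

Definition fock_weighted (alpha : R) (f : R[i] -> R[i]) (z : R * R) : R :=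
  ComplexField.Normc.normc (f (cplx z)) * expR (- (alpha * ComplexField.Normc.normc (cplx z) ^+ 2) / 2).

Definition fock_integral (p alpha : R) (f : R[i] -> R[i]) : \bar R :=
  (\int[area]_z ((fock_weighted alpha f z) `^ p)%:E)%E.

Definition in_Fock (p alpha : R) (f : R[i] -> R[i]) : Prop :=
  entire f /\ (fock_integral p alpha f < +oo)%E.

(* ||f||_{p,alpha} (meaningful for f in F^p_alpha) *)
Definition fock_norm (p alpha : R) (f : R[i] -> R[i]) : R :=
  (p * alpha / (2 * pi) * fine (fock_integral p alpha f)) `^ p^-1.

Definition FC_measure_q (p q alpha : R)
    (mu : {measure set (R * R) -> \bar R}) : Prop :=
  exists2 C : R, 0 < C & forall f, in_Fock p alpha f ->
    ((\int[mu]_z ((fock_weighted alpha f z) `^ q)%:E) `^ q^-1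
      <= (C * fock_norm p alpha f)%:E)%E.

Definition FC_measure_inf (p alpha : R)
    (mu : {measure set (R * R) -> \bar R}) : Prop :=
  exists2 C : R, 0 < C & forall f, in_Fock p alpha f ->
    (ess_sup mu (fun z => (fock_weighted alpha f z)%:E)
      <= (C * fock_norm p alpha f)%:E)%E.

End Fock.

(* Main.v *)
(* Both sides hold for every finite mu, by the pointwise estimate
   |f(w)| e^(-alpha |w|^2 / 2) <= C ||f||_(p,alpha), valid for all p > 0.
   - Goursat without integrals: trapezoidal sums are exact on affine functions and
     additive under subdivision, so the usual bisection shows that the trapezoidal
     boundary sums of an entire function over a parallelogram tend to 0.
   - For an entire function with period 2 pi i this compares its averages over two
     vertical segments; applied to (f (a + e^w) - f a) / e^w it gives Cauchy's
     estimate for f' a, hence a Lipschitz bound for bounded entire functions on discs.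
   - By the Hardy-Littlewood trick, every entire g satisfies |g| >= c |g 0| / r^(m+1)
     on some square of side ~ r in the unit disc, so that the integral of |g|^p
     dominates |g 0|^p once (m+1) p >= 2. Take g z = f (w + z) e^(- alpha conj(w) z). *)
Require Import Defs.
From HB Require Import structures.
From mathcomp Require Import all_boot all_order all_algebra.
From mathcomp Require Import all_classical all_reals all_analysis.
From mathcomp Require Import ess_sup_inf ring lra.
From mathcomp.real_closed Require Import complex.
Import Order.TTheory GRing.Theory Num.Theory.
Local Open Scope ring_scope.

Section FockPointwise.
Local Open Scope complex_scope.
Set Implicit Arguments. Unset Strict Implicit. Unset Printing Implicit Defensive.
Variable R : realType.
Local Notation normc := ComplexField.Normc.normc.
Local Notation Re := complex.Re.
Local Notation Im := complex.Im.
Implicit Types (f g : R[i] -> R[i]) (a b h z u v w d : R[i]).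

(** * Bisection principle for squares *)

(** A square where [P] fails has a quarter where it fails; the resulting nested squares shrink to a
    point, against the local hypothesis there. This is the compactness argument behind Goursat's
    theorem, the mean value inequality and local-to-global boundedness below. *)
Lemma square_bisection (P : R -> R -> R -> Prop) (s0 t0 r0 : R) :
  (forall s t r, P s t (r / 2) -> P (s + r / 2) t (r / 2) ->
     P s (t + r / 2) (r / 2) -> P (s + r / 2) (t + r / 2) (r / 2) -> P s t r) ->
  (forall s t, s0 <= s <= s0 + r0 -> t0 <= t <= t0 + r0 ->
     exists2 e, 0 < e & forall s' t' r, 0 < r < e ->
       s' <= s <= s' + r -> t' <= t <= t' + r -> P s' t' r) ->
  0 < r0 -> P s0 t0 r0.
Proof.
move=> Psub Ploc r0_gt0; apply: contrapT => NP0.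
pose half (x0 x r : R) := x = x0 \/ x = x0 + r / 2.
have /choice[nxt nxtP] (x : R * R * R) : exists y : R * R * R,
    ~ P x.1.1 x.1.2 x.2 -> [/\ ~ P y.1.1 y.1.2 y.2, y.2 = x.2 / 2,
      half x.1.1 y.1.1 x.2 & half x.1.2 y.1.2 x.2].
  case: x => [[s t] r] /=; have [Px|NP] := pselect (P s t r); first by exists (s, t, r).
  have : ~ (P s t (r / 2) /\ P (s + r / 2) t (r / 2) /\
    P s (t + r / 2) (r / 2) /\ P (s + r / 2) (t + r / 2) (r / 2)).
    by case=> [? [? [? ?]]]; apply: NP; apply: Psub.
  rewrite /half; move=> /not_andP[N|/not_andP[N|/not_andP[N|N]]].
  - by exists (s, t, r / 2) => _; split; auto.
  - by exists (s + r / 2, t, r / 2) => _; split; auto.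
  - by exists (s, t + r / 2, r / 2) => _; split; auto.
  - by exists (s + r / 2, t + r / 2, r / 2) => _; split; auto.
pose X n := iter n nxt (s0, t0, r0).
have NX n : ~ P (X n).1.1 (X n).1.2 (X n).2.
  by elim: n => [//|n IH]; have [] := nxtP _ IH.
pose r n := (X n).2.
have rS n : r n.+1 = r n / 2 by have [] := nxtP _ (NX n).
have rE n : r n = r0 / 2 ^+ n.
  elim: n => [|n IH]; first by rewrite expr0 divr1.
  by rewrite rS IH exprSr invfM mulrA.
have r_gt0 n : 0 < r n by rewrite rE divr_gt0 ?exprn_gt0.
(* Nested intervals, one coordinate at a time: the supremum of the left endpoints lies in all of
   them. *)
have nestP (x : nat -> R) (x0 : R) : x 0%N = x0 ->
    (forall n, half (x n) (x n.+1) (r n)) ->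
    exists2 xi, x0 <= xi <= x0 + r0 & forall n, x n <= xi <= x n + r n.
  move=> xX0 xS.
  have step n : x n <= x n.+1 /\ x n.+1 + r n.+1 <= x n + r n.
    by rewrite rS; have := r_gt0 n; case: (xS n) => ->; lra.
  have le_l n k : x n <= x (n + k)%N.
    by elim: k => [|k IH]; rewrite ?addn0// addnS; apply: le_trans IH (proj1 (step _)).
  have le_r n k : x (n + k)%N + r (n + k)%N <= x n + r n.
    by elim: k => [|k IH]; rewrite ?addn0// addnS; apply: le_trans (proj2 (step _)) IH.
  have ub n m : x m <= x n + r n.
    have := le_l m n; have := le_r n m; rewrite addnC; have := r_gt0 (m + n)%N; lra.
  pose A := [set x n | n in setT]%classic.
  have A0 : (A !=set0)%classic by exists (x 0%N), 0%N.
  have An n : x n <= sup A <= x n + r n.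
    apply/andP; split; last by apply: ge_sup => // _ [m _ <-]; exact: ub.
    apply: ub_le_sup; last by exists n.
    by exists (x 0%N + r 0%N) => _ [m _ <-]; exact: ub.
  exists (sup A) => //; have := An 0%N.
  by rewrite xX0 rE expr0 divr1.
have [||s s_in sP] := nestP (fun n => (X n).1.1) s0 => //.
  by move=> n; have [] := nxtP _ (NX n).
have [||t t_in tP] := nestP (fun n => (X n).1.2) t0 => //.
  by move=> n; have [] := nxtP _ (NX n).
have [e e_gt0 eP] := Ploc s t s_in t_in.
(* From [r0 / e < n < 2 ^ n] the n-th side is below [e]. *)
pose n := Num.bound (r0 / e).
have rn : r n < e.
  rewrite rE ltr_pdivrMr ?exprn_gt0// -ltr_pdivrMl// mulrC.
  apply: lt_trans (archi_boundP _) _; first by rewrite divr_ge0// ltW.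
  by rewrite -natrX ltr_nat ltn_expl.
by apply: (NX n); apply: eP; rewrite ?r_gt0.
Qed.

(** * The real-valued modulus *)

Lemma normc_ge0 z : 0 <= normc z. Proof. by case: z => x y; exact: sqrtr_ge0. Qed.

Lemma normc_gt0 z : z != 0 -> 0 < normc z.
Proof.
move=> z0; rewrite lt_neqAle normc_ge0 andbT eq_sym; apply: contra z0 => /eqP.
by move/ComplexField.Normc.eq0_normc => ->.
Qed.

Lemma normcB z w : normc (z - w) = normc (w - z).
Proof. by rewrite -normcN opprB. Qed.

Lemma normc_le_add z w : normc z <= normc (z - w) + normc w.
Proof. by rewrite -{1}(subrK w z) le_normcD. Qed.

Lemma normcR (x : R) : normc x%:C = `|x|.
Proof. by rewrite /= expr0n addr0 sqrtr_sqr. Qed.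

Lemma normc_Re z : `|Re z| <= normc z.
Proof. by case: z => x y /=; rewrite -sqrtr_sqr ler_wsqrtr// lerDl sqr_ge0. Qed.

Lemma normc_Im z : `|Im z| <= normc z.
Proof. by case: z => x y /=; rewrite -sqrtr_sqr ler_wsqrtr// lerDr sqr_ge0. Qed.

Lemma normc_leD (x y : R) : normc (x +i* y) <= `|x| + `|y|.
Proof.
have -> : x +i* y = x%:C + 'i * y%:C by rewrite [RHS]/= ; congr (_ +i* _); ring.
apply: le_trans (le_normcD _ _) _.
by rewrite ComplexField.Normc.normcM !normcR /= expr0n expr1n add0r sqrtr1 mul1r.
Qed.

(** * Trapezoidal sums and Goursat's theorem *)

(** Complex differentiability as first-order approximation: free of division, and with real epsilon
    and radius in place of positive elements of [R[i]]. *)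
Definition cderiv f z d := forall e : R, 0 < e -> exists2 r : R, 0 < r &
  forall h, normc h < r -> normc (f (z + h) - f z - d * h) <= e * normc h.

Definition holo f := forall z, exists d, cderiv f z d.

(** The trapezoidal rule with 2^n equal pieces for the integral of f along the segment from [a] to
    [a + u]. *)
Fixpoint edge_sum f n a u : R[i] :=
  if n is n'.+1 then edge_sum f n' a (u / 2) + edge_sum f n' (a + u / 2) (u / 2)
  else (f a + f (a + u)) / 2 * u.

(** A discrete contour integral around the parallelogram spanned by u and v at a, defined by
    quartering so that additivity under bisection is built in. *)
Fixpoint cell_sum f n a u v : R[i] :=
  if n is n'.+1 then
    cell_sum f n' a (u / 2) (v / 2) + cell_sum f n' (a + u / 2) (u / 2) (v / 2) +
    cell_sum f n' (a + v / 2) (u / 2) (v / 2) +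
    cell_sum f n' (a + u / 2 + v / 2) (u / 2) (v / 2)
  else edge_sum f 0 a u + edge_sum f 0 (a + u) v
     - edge_sum f 0 (a + v) u - edge_sum f 0 a v.

(** Each inner edge is shared by two quarters with opposite orientations and cancels. *)
Lemma cell_sumE f n a u v : cell_sum f n a u v =
  edge_sum f n a u + edge_sum f n (a + u) v - edge_sum f n (a + v) u - edge_sum f n a v.
Proof.
elim: n a u v => [//|n IH] a u v; rewrite [LHS]/= !IH /=.
have -> : a + v / 2 + u / 2 = a + u / 2 + v / 2 by ring.
have -> : a + u / 2 + u / 2 = a + u by field.
have -> : a + v / 2 + v / 2 = a + v by field.
have -> : a + u / 2 + v / 2 + u / 2 = a + u + v / 2 by field.
have -> : a + u / 2 + v / 2 + v / 2 = a + v + u / 2 by field.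
ring.
Qed.

(** The trapezoidal rule is exact on affine functions, which have a primitive, so their sum around a
    closed boundary is 0. *)
Lemma cell_sum_affine f g c d n a u v : (forall z, f z = g z + (c + d * z)) ->
  cell_sum f n a u v = cell_sum g n a u v.
Proof.
move=> fg; elim: n a u v => [|n IH] a u v /=; last by rewrite !IH.
by rewrite !fg; field.
Qed.

Lemma edge_sum_le f n a u (K : R) :
  (forall t : R, 0 <= t <= 1 -> normc (f (a + t%:C * u)) <= K) ->
  normc (edge_sum f n a u) <= K * normc u.
Proof.
have n2 : normc (2^-1 : R[i]) = 2^-1.
  rewrite ComplexField.Normc.normcV; congr (_^-1).
  by rewrite -[2]/(2%:R) -(rmorph_nat (real_complex R)) normcR ger0_norm.
elim: n a u => [|n IH] a u fK /=.
  rewrite !ComplexField.Normc.normcM n2 ler_wpM2r ?normc_ge0//.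
  have := fK 0; rewrite lexx ler01 mul0r addr0 => /(_ isT) f0.
  have := fK 1; rewrite lexx ler01 mul1r => /(_ isT) f1.
  have := le_normcD (f a) (f (a + u)); lra.
apply: le_trans (le_normcD _ _) _.
have H1 : normc (edge_sum f n a (u / 2)) <= K * normc (u / 2).
  apply: IH => t t01; rewrite (_ : t%:C * (u / 2) = (t / 2)%:C * u); first by apply: fK; lra.
  by rewrite rmorphM fmorphV rmorph_nat; field.
have H2 : normc (edge_sum f n (a + u / 2) (u / 2)) <= K * normc (u / 2).
  apply: IH => t t01; rewrite -addrA.
  rewrite (_ : u / 2 + t%:C * (u / 2) = ((1 + t) / 2)%:C * u); first by apply: fK; lra.
  by rewrite rmorphM fmorphV rmorphD rmorph1 rmorph_nat; field.
apply: le_trans (lerD H1 H2) _.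
by rewrite ComplexField.Normc.normcM n2; lra.
Qed.

Lemma cell_sum_le f n a u v (K : R) :
  (forall x y : R, 0 <= x <= 1 -> 0 <= y <= 1 ->
     normc (f (a + x%:C * u + y%:C * v)) <= K) ->
  normc (cell_sum f n a u v) <= K * (2 * (normc u + normc v)).
Proof.
move=> fK; rewrite cell_sumE.
have i0 : 0 <= (0 : R) <= 1 by rewrite lexx ler01.
have i1 : 0 <= (1 : R) <= 1 by rewrite lexx ler01.
have H1 : normc (edge_sum f n a u) <= K * normc u.
  by apply: edge_sum_le => t ti; have := fK _ _ ti i0; rewrite mul0r addr0.
have H2 : normc (edge_sum f n (a + u) v) <= K * normc v.
  by apply: edge_sum_le => t ti; have := fK _ _ i1 ti; rewrite mul1r.
have H3 : normc (edge_sum f n (a + v) u) <= K * normc u.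
  by apply: edge_sum_le => t ti; have := fK _ _ ti i1; rewrite mul1r addrAC.
have H4 : normc (edge_sum f n a v) <= K * normc v.
  by apply: edge_sum_le => t ti; have := fK _ _ i0 ti; rewrite mul0r addr0.
have D1 := le_normcD (edge_sum f n a u + edge_sum f n (a + u) v - edge_sum f n (a + v) u)
  (- edge_sum f n a v).
have D2 := le_normcD (edge_sum f n a u + edge_sum f n (a + u) v) (- edge_sum f n (a + v) u).
have D3 := le_normcD (edge_sum f n a u) (edge_sum f n (a + u) v).
rewrite !normcN in D1 D2; lra.
Qed.

(** The bound [e * r ^+ 2] is proportional to area, hence additive over quarters. On a small cell
    the affine part of f drops out; the remainder and the perimeter are both of order r. *)
Lemma cell_sum_to0 f a u v (e : R) : holo f -> 0 < e ->
  exists N, forall n, (N <= n)%N -> normc (cell_sum f n a u v) <= e.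
Proof.
move=> hf e0.
pose P (s t r : R) := exists N, forall n, (N <= n)%N ->
  normc (cell_sum f n (a + s%:C * u + t%:C * v) (r%:C * u) (r%:C * v)) <= e * r ^+ 2.
suff: P 0 0 1 by rewrite /P !mul0r !addr0 !mul1r expr1n mulr1.
apply: square_bisection; last exact: ltr01.
- move=> s t r [N1 P1] [N2 P2] [N3 P3] [N4 P4].
  (* One more level, since a sum at level n+1 is made of quarter sums at level n. *)
  exists (maxn (maxn N1 N2) (maxn N3 N4)).+1 => -[//|n].
  rewrite ltnS !geq_max => /andP[/andP[/P1 {}P1 /P2 {}P2] /andP[/P3 {}P3 /P4 {}P4]].
  have half w : r%:C * w / 2 = (r / 2)%:C * w.
    by rewrite rmorphM fmorphV rmorph_nat; ring.
  rewrite /= !half.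
  move: P1 P2 P3 P4; rewrite !rmorphD !mulrDl !addrA.
  set b := a + _ + _.
  rewrite (_ : a + s%:C * u + (r / 2)%:C * u + t%:C * v = b + (r / 2)%:C * u); last first.
    by rewrite /b; ring.
  set c1 := cell_sum _ _ _ _ _; set c2 := cell_sum _ _ _ _ _.
  set c3 := cell_sum _ _ _ _ _; set c4 := cell_sum _ _ _ _ _ => P1 P2 P3 P4.
  have D1 := le_normcD (c1 + c2 + c3) c4.
  have D2 := le_normcD (c1 + c2) c3.
  have D3 := le_normcD c1 c2.
  have : e * (r / 2) ^+ 2 *+ 4 = e * r ^+ 2 by field.
  rewrite -mulr_natr; lra.
- move=> s t _ _; set z := a + s%:C * u + t%:C * v.
  pose L := normc u + normc v + 1.
  have L0 : 0 < L by rewrite /L; have := normc_ge0 u; have := normc_ge0 v; lra.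
  have [d dP] := hf z.
  (* Points of the cell are within [r * L] of z and its perimeter is at most [2 * (r * L)]; this
     constant turns the product into [e * r ^+ 2]. *)
  have [|rho rho0 rhoP] := dP (e / (2 * L ^+ 2)).
    by rewrite divr_gt0// mulr_gt0// exprn_gt0.
  exists (rho / L) => [|s' t' r /andP[r0]]; first by rewrite divr_gt0.
  rewrite ltr_pdivlMr// => rL ss tt; exists 0%N => n _.
  pose g w := f w - (f z - d * z + d * w).
  rewrite (@cell_sum_affine f g (f z - d * z) d); last by move=> w; rewrite /g subrK.
  apply: (@le_trans _ _ (e / (2 * L ^+ 2) * (r * L) * (2 * (normc (r%:C * u) + normc (r%:C * v))))).
    apply: cell_sum_le => x y xi yi.
    set w := _ + y%:C * _.
    have wz : normc (w - z) <= r * L.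
      rewrite (_ : w - z = (s' + x * r - s)%:C * u + (t' + y * r - t)%:C * v); last first.
        by rewrite /w /z !(rmorphD, rmorphN, rmorphM); ring.
      apply: le_trans (le_normcD _ _) _.
      rewrite !ComplexField.Normc.normcM !normcR.
      have : `|s' + x * r - s| <= r by rewrite ler_norml; nra.
      have : `|t' + y * r - t| <= r by rewrite ler_norml; nra.
      have := normc_ge0 u; have := normc_ge0 v.
      rewrite /L; nra.
    have := rhoP (w - z) (le_lt_trans wz rL).
    rewrite /g (addrC z) subrK => /le_trans.
    rewrite (_ : f w - f z - d * (w - z) = f w - (f z - d * z + d * w)); last by ring.
    apply; rewrite ler_wpM2l// divr_ge0 ?ltW// mulr_gt0// exprn_gt0//.
  rewrite !ComplexField.Normc.normcM normcR (gtr0_norm r0) -mulrDr.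
  rewrite -[leRHS]mulr1.
  have -> : e * r ^+ 2 * 1 = e / (2 * L ^+ 2) * (r * L) * (2 * (r * L)).
    by field; rewrite gt_eqF.
  rewrite ler_wpM2l//; first by rewrite !mulr_ge0 ?invr_ge0 ?mulr_ge0 ?exprn_ge0// ltW.
  by rewrite ler_wpM2l// ler_wpM2l ?ltW// /L; lra.
Qed.

(** * Averages of periodic entire functions *)

Lemma edge_sum_sub f (c : R[i]) n a u :
  edge_sum (fun z => f z - c) n a u = edge_sum f n a u - c * u.
Proof. by elim: n a u => [|n IH] a u /=; rewrite ?IH; field. Qed.

Lemma edge_sum_periodic f v n a u : (forall z, f (z + v) = f z) ->
  edge_sum f n (a + v) u = edge_sum f n a u.
Proof.
move=> fv; elim: n a u => [|n IH] a u /=; first by rewrite addrAC !fv.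
by rewrite addrAC !IH.
Qed.

(* The averages of f over the period v at a and at b agree by the vanishing of cell
   sums, since the two sides parallel to a - b cancel by periodicity. *)
Lemma periodic_limit_le f v (c : R[i]) (K : R) a : holo f -> v != 0 ->
  (forall z, f (z + v) = f z) ->
  (forall t : R, normc (f (a + t%:C * v)) <= K) ->
  (forall e : R, 0 < e -> exists b, forall t : R, normc (f (b + t%:C * v) - c) <= e) ->
  normc c <= K.
Proof.
move=> hf /normc_gt0 v0 fv fK fc; apply/ler_addgt0Pl => e e0.
have [b fb] := fc (e / 2) (divr_gt0 e0 (ltr0n _ 2)).
(* Half the tolerance goes to the cell sum, half to the deviation of f from c at b; the factor
   [normc v] turns averages into edge sums. *)
have [|N /(_ N (leqnn N))] := @cell_sum_to0 f b (a - b) v (e / 2 * normc v) hf.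
  by rewrite mulr_gt0// divr_gt0.
rewrite cell_sumE (addrC b) subrK edge_sum_periodic//.
set E := edge_sum f N b (a - b) => H.
have Ha : normc (edge_sum f N a v) <= K * normc v by apply: edge_sum_le.
have : normc (edge_sum (fun z => f z - c) N b v) <= e / 2 * normc v by apply: edge_sum_le.
rewrite edge_sum_sub => Hb.
rewrite -(ler_pM2r v0) -ComplexField.Normc.normcM.
rewrite (_ : c * v = edge_sum f N a v - (E + edge_sum f N a v - E - edge_sum f N b v)
   - (edge_sum f N b v - c * v)); last by ring.
have D1 := le_normcD (edge_sum f N a v - (E + edge_sum f N a v - E - edge_sum f N b v))
   (- (edge_sum f N b v - c * v)).
have D2 := le_normcD (edge_sum f N a v) (- (E + edge_sum f N a v - E - edge_sum f N b v)).
rewrite !normcN in D1 D2; lra.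
Qed.

(** * Rules of complex differentiation *)

Lemma cderiv_lipschitz f z d : cderiv f z d -> exists2 r : R, 0 < r &
  forall h, normc h < r -> normc (f (z + h) - f z) <= (normc d + 1) * normc h.
Proof.
move=> /(_ 1 ltr01)[r r0 fr]; exists r => // h /fr.
have := le_normcD (f (z + h) - f z - d * h) (d * h).
by rewrite subrK ComplexField.Normc.normcM; lra.
Qed.

Lemma cderivM f g z d1 d2 : cderiv f z d1 -> cderiv g z d2 ->
  cderiv (fun w => f w * g w) z (d1 * g z + f z * d2).
Proof.
move=> fd gd e e0.
have [r1 r10 f1] := cderiv_lipschitz fd; have [r2 r20 g1] := cderiv_lipschitz gd.
set A := normc d1 + 1 in f1; set B := normc d2 + 1 in g1.
have A0 : 0 < A by rewrite /A; have := normc_ge0 d1; lra.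
have B0 : 0 < B by rewrite /B; have := normc_ge0 d2; lra.
set C := normc (f z) + normc (g z) + 1.
have C0 : 0 < C by rewrite /C; have := normc_ge0 (f z); have := normc_ge0 (g z); lra.
have [|r3 r30 f2] := fd (e / (2 * C)); first by rewrite divr_gt0// mulr_gt0.
have [|r4 r40 g2] := gd (e / (2 * C)); first by rewrite divr_gt0// mulr_gt0.
(* The last radius controls the product of the two increments, which is at most
   [A * B * normc h ^+ 2]. *)
exists (Num.min (Num.min r1 r2) (Num.min (Num.min r3 r4) (e / (2 * A * B)))).
  by rewrite !lt_min r10 r20 r30 r40/= divr_gt0 ?mulr_gt0.
move=> h; rewrite !lt_min => /andP[/andP[/f1 {}f1 /g1 {}g1]].
move=> /andP[/andP[/f2 {}f2 /g2 {}g2]].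
rewrite ltr_pdivlMr ?mulr_gt0// => he.
rewrite (_ : _ - _ = (f (z + h) - f z - d1 * h) * g z + f z * (g (z + h) - g z - d2 * h)
  + (f (z + h) - f z) * (g (z + h) - g z)); last by ring.
apply: le_trans (le_normcD _ _) _; apply: le_trans (lerD (le_normcD _ _) (lexx _)) _.
rewrite !ComplexField.Normc.normcM.
have h1 : normc (f (z + h) - f z - d1 * h) * normc (g z) <=
    e / (2 * C) * normc h * normc (g z) by rewrite ler_wpM2r ?normc_ge0.
have h2 : normc (f z) * normc (g (z + h) - g z - d2 * h) <=
    normc (f z) * (e / (2 * C) * normc h) by rewrite ler_wpM2l ?normc_ge0.
have h3 : normc (f (z + h) - f z) * normc (g (z + h) - g z) <=
    A * normc h * (B * normc h) by apply: ler_pM; rewrite ?normc_ge0.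
have h4 : e / (2 * C) * normc h * (normc (f z) + normc (g z)) <=
    e / (2 * C) * normc h * C.
  apply: ler_wpM2l; last by rewrite /C; lra.
  by rewrite mulr_ge0 ?normc_ge0// divr_ge0 ?mulr_ge0// ltW.
have h5 : normc h * (2 * A * B) * normc h <= e * normc h.
  by rewrite ler_wpM2r ?normc_ge0// ltW.
have h6 : e / (2 * C) * normc h * C = e * normc h / 2 by field; rewrite gt_eqF.
lra.
Qed.

Lemma cderiv_comp f g z d1 d2 : cderiv f (g z) d1 -> cderiv g z d2 ->
  cderiv (fun w => f (g w)) z (d1 * d2).
Proof.
move=> fd gd e e0.
have [r1 r10 g1] := cderiv_lipschitz gd.
set B := normc d2 + 1 in g1.
have B0 : 0 < B by rewrite /B; have := normc_ge0 d2; lra.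
set D := normc d1 + 1.
have D0 : 0 < D by rewrite /D; have := normc_ge0 d1; lra.
have [|r2 r20 f2] := fd (e / (2 * B)); first by rewrite divr_gt0// mulr_gt0.
have [|r3 r30 g2] := gd (e / (2 * D)); first by rewrite divr_gt0// mulr_gt0.
exists (Num.min (Num.min r1 r3) (r2 / B)).
  by rewrite !lt_min r10 r30 divr_gt0.
move=> h; rewrite !lt_min => /andP[/andP[/g1 {}g1 /g2 {}g2]].
rewrite ltr_pdivlMr// => hB.
have f3 := f2 (g (z + h) - g z).
rewrite [g z + _]addrC subrK in f3.
have {}f3 := f3 (le_lt_trans g1 _); rewrite mulrC in f3; have {}f3 := f3 hB.
set k := g (z + h) - g z in g1 g2 f3.
rewrite (_ : _ - _ = (f (g (z + h)) - f (g z) - d1 * k) + d1 * (k - d2 * h)); last by ring.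
apply: le_trans (le_normcD _ _) _; rewrite ComplexField.Normc.normcM.
have h1 : e / (2 * B) * normc k <= e / (2 * B) * (B * normc h).
  by rewrite ler_wpM2l// divr_ge0 ?mulr_ge0// ltW.
have h2 : normc d1 * normc (k - d2 * h) <= D * (e / (2 * D) * normc h).
  by apply: ler_pM; rewrite ?normc_ge0// /D; lra.
have h3 : e / (2 * B) * (B * normc h) = e * normc h / 2 by field; rewrite gt_eqF.
have h4 : D * (e / (2 * D) * normc h) = e * normc h / 2 by field; rewrite gt_eqF.
lra.
Qed.

Lemma cderiv_affine (b c : R[i]) z : cderiv (fun w => b + c * w) z c.
Proof.
move=> e e0; exists 1 => // h _.
rewrite (_ : _ - _ = 0); last by ring.
by rewrite ComplexField.Normc.normc0 mulr_ge0 ?normc_ge0// ltW.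
Qed.

Lemma cderiv_subc f (c : R[i]) z d : cderiv f z d -> cderiv (fun w => f w - c) z d.
Proof.
move=> fd e /fd[r r0 fr]; exists r => // h /fr.
by rewrite (_ : f (z + h) - c - (f z - c) = f (z + h) - f z); last by ring.
Qed.

(** * The complex exponential and the link with library derivatives *)

Definition cexp z : R[i] := expR (Re z) * cos (Im z) +i* (expR (Re z) * sin (Im z)).

Lemma cexpD z w : cexp (z + w) = cexp z * cexp w.
Proof.
case: z w => [x y] [x' y']; apply/eqP; rewrite eq_complex /= expRD cosD sinD.
by apply/andP; split; apply/eqP; ring.
Qed.

Lemma cexp0 : cexp 0 = 1.
Proof. by rewrite /cexp /= expR0 cos0 sin0 mulr0 mulr1. Qed.

Lemma normc_cexp z : normc (cexp z) = expR (Re z).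
Proof.
rewrite /cexp /= !exprMn -mulrDr cos2Dsin2 mulr1 sqrtr_sqr ger0_norm//.
Qed.

Lemma cexp_neq0 z : cexp z != 0.
Proof.
apply/eqP => z0; have := normc_cexp z; rewrite z0 ComplexField.Normc.normc0.
by have := expR_gt0 (Re z); lra.
Qed.

Lemma cexpN z : cexp (- z) = (cexp z)^-1.
Proof.
by apply: (mulfI (cexp_neq0 z)); rewrite -cexpD subrr cexp0 divff ?cexp_neq0.
Qed.

(** Stated over any [numFieldType] so as to serve both entire functions on [R[i]] and the real
    functions exp, cos and sin. *)
Lemma derivable_increment (K : numFieldType) (f : K^o -> K^o) (x : K) :
  derivable f x 1 -> forall e : K, 0 < e -> exists2 r : K, 0 < r &
  forall h : K, `|h| < r -> `|f (x + h) - f x - 'D_1 f x * h| <= e * `|h|.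
Proof.
move=> df e e0.
have /cvgrPdist_le := df; move=> /(_ e e0) H.
have [r /= r0 fr] := proj1 (nbhs_ballP (0 : K^o) _) H.
exists r => // k kr; have [->|k0] := eqVneq k 0.
  by rewrite addr0 mulr0 !subrr normr0 mulr0.
have {}kr : ball (0 : K^o) r k by rewrite -ball_normE /= sub0r normrN.
have -> : f (x + k) - f x - 'D_1 f x * k =
    - (('D_1 f x - k^-1 *: (f (k *: (1 : K^o) + x) - f x)) * k).
  rewrite /GRing.scale /= mulr1 (addrC k) mulrBl mulrAC mulVf// mul1r; ring.
by rewrite normrN normrM ler_wpM2r//; exact: fr kr k0.
Qed.

Lemma normCE z : `|z| = (normc z)%:C. Proof. by case: z. Qed.

Lemma entire_holo f : entire f -> holo f.
Proof.
move=> fe z; exists ('D_1 (f : R[i]^o -> R[i]^o) z) => e e0.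
have [|r r0 fr] := @derivable_increment _ f z (fe z) e%:C; first by rewrite ltcR.
(* In the partial order of [R[i]], a positive element is real. *)
have [r'0 rE] : 0 < Re r /\ r = (Re r)%:C.
  by case: r r0 {fr} => x y; rewrite ltcE /= => /andP[/eqP -> ->].
exists (Re r) => // h hr.
have := fr h; rewrite rE !normCE -rmorphM ltcR lecR; exact.
Qed.

Lemma increment_is_derive (f : R -> R) (x d : R) : is_derive x 1 f d ->
  forall e : R, 0 < e -> exists2 r : R, 0 < r &
  forall h : R, `|h| < r -> `|f (x + h) - f x - d * h| <= e * `|h|.
Proof.
move=> fd; have := @derivable_increment R f x (@ex_derive _ _ _ _ _ _ _ fd).
by rewrite derive_val.
Qed.

(** The addition law reduces this to the point 0, where the real expansions of exp, cos and sin are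
    combined. *)
Lemma cderiv_cexp z : cderiv cexp z (cexp z).
Proof.
suff H : cderiv cexp 0 1.
  rewrite -[cexp z]mulr1.
  have -> : cexp z * 1 = 0 * cexp (z - z) + cexp z * (1 * 1) by ring.
  have [d0 d1] : cderiv (fun=> cexp z) z 0 /\ cderiv (fun w => cexp (w - z)) z (1 * 1).
    split; first by have := @cderiv_affine (cexp z) 0 z; under eq_fun do rewrite mul0r addr0.
    apply: cderiv_comp; first by rewrite subrr.
    by have := @cderiv_affine (- z) 1 z; under eq_fun do rewrite mul1r addrC.
  have := cderivM d0 d1.
  by under eq_fun do rewrite -cexpD addrCA subrr addr0.
(* The error terms below add up to [6 * e' * normc h]; the cap at 1 keeps [expR x] at most 2. *)
move=> e e0; pose e' := Num.min (e / 8) 1.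
have e'0 : 0 < e' by rewrite lt_min ltr01 divr_gt0.
have e'1 : e' <= 1 by rewrite ge_min lexx orbT.
have e'e : 8 * e' <= e by rewrite mulrC -ler_pdivlMr// ge_min lexx.
have [r1 r10 E] := increment_is_derive (is_derive_expR 0) e'0.
have [r2 r20 C] := increment_is_derive (is_derive_cos 0) e'0.
have [r3 r30 S] := increment_is_derive (is_derive_sin 0) e'0.
rewrite !sin0 !cos0 !expR0 oppr0 in E C S.
exists (Num.min (Num.min r1 r2) (Num.min r3 (e' / 2))).
  by rewrite !lt_min r10 r20 r30/= divr_gt0.
move=> h; rewrite !lt_min => /andP[/andP[h1 h2] /andP[h3 h4]].
have xh := normc_Re h; have yh := normc_Im h.
have {E} := E _ (le_lt_trans xh h1); have {C} := C _ (le_lt_trans yh h2).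
have {S} := S _ (le_lt_trans yh h3).
rewrite add0r cexp0 mul1r !add0r !mul0r !mul1r addr0 subr0 => S C E.
set H := normc h in xh yh h4 *.
have -> : cexp h - 1 - h = ((expR (Re h) - 1 - Re h) + expR (Re h) * (cos (Im h) - 1)) +i*
    (expR (Re h) * (sin (Im h) - Im h) + (expR (Re h) - 1) * Im h).
  rewrite /cexp; case: (h) => x y /=.
  by apply/eqP; rewrite eq_complex /=; apply/andP; split; apply/eqP; ring.
set x := Re h in xh E *; set y := Im h in yh S C *.
apply: le_trans (normc_leD _ _) _.
have H0 : 0 <= H := normc_ge0 h.
have x1 : `|expR x - 1| <= e'.
  have := ler_normD (expR x - 1 - x) x; rewrite subrK => /le_trans; apply.
  apply: le_trans (lerD E xh) _; nra.
have e2 : `|expR x| <= 2.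
  by have := ler_normD (expR x - 1) 1; rewrite subrK normr1 => /le_trans; apply; lra.
have T1 := ler_normD (expR x - 1 - x) (expR x * (cos y - 1)).
have T2 := ler_normD (expR x * (sin y - y)) ((expR x - 1) * y).
rewrite !normrM in T1 T2.
have E' : e' * `|x| <= e' * H by rewrite ler_wpM2l// ltW.
have Y' : e' * `|y| <= e' * H by rewrite ler_wpM2l// ltW.
have C1 : `|expR x| * `|cos y - 1| <= 2 * (e' * H).
  by apply: ler_pM => //; exact: le_trans C Y'.
have S1 : `|expR x| * `|sin y - y| <= 2 * (e' * H).
  by apply: ler_pM => //; exact: le_trans S Y'.
have X1 : `|expR x - 1| * `|y| <= e' * H by apply: ler_pM.
have : 8 * e' * H <= e * H by rewrite ler_wpM2r.
have : 0 <= e' * H by rewrite mulr_ge0// ltW.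
lra.
Qed.

(** * Closure properties, Cauchy's estimate and the Lipschitz bound *)

Lemma holoM f g : holo f -> holo g -> holo (fun z => f z * g z).
Proof.
move=> hf hg z; have [d1 D1] := hf z; have [d2 D2] := hg z.
by exists (d1 * g z + f z * d2); exact: cderivM.
Qed.

Lemma holo_comp f g : holo f -> holo g -> holo (fun z => f (g z)).
Proof.
move=> hf hg z; have [d1 D1] := hf (g z); have [d2 D2] := hg z.
by exists (d1 * d2); exact: cderiv_comp.
Qed.

Lemma holo_subc f (c : R[i]) : holo f -> holo (fun z => f z - c).
Proof. by move=> hf z; have [d D] := hf z; exists d; exact: cderiv_subc. Qed.

Lemma holo_affine (b c : R[i]) : holo (fun z => b + c * z).
Proof. by move=> z; exists c; exact: cderiv_affine. Qed.

Lemma holo_cexp : holo cexp.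
Proof. by move=> z; exists (cexp z); exact: cderiv_cexp. Qed.

(* The function w |-> (f (a + e^w) - f a) / e^w is entire, has period 2 pi i and
   tends to f' a as Re w goes to -oo. *)
Lemma cderiv_le f a d (rho M : R) : holo f -> cderiv f a d -> 0 < rho ->
  (forall z, normc (z - a) <= rho -> normc (f z) <= M) ->
  normc d <= 2 * M / rho.
Proof.
move=> hf fd rho0 fM.
(* The factor [1] and the summand [0] give the shape of [holo_affine]. *)
pose q w := (f (a + 1 * cexp w) - f a) * cexp (0 + -1 * w).
have hq : holo q.
  apply: holoM; last exact: holo_comp holo_cexp (@holo_affine _ _).
  apply: (holo_subc (f a)); apply: (holo_comp hf).
  exact: holo_comp (@holo_affine a 1) holo_cexp.
pose v : R[i] := 0 +i* (pi + pi).
have nq w : normc (q w) = normc (f (a + cexp w) - f a) / expR (Re w).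
  rewrite /q mul1r add0r mulN1r cexpN ComplexField.Normc.normcM.
  by rewrite ComplexField.Normc.normcV normc_cexp.
have Re_v (x t : R) : Re (x%:C + t%:C * v) = x by rewrite /v /=; ring.
(* The exponential maps the vertical line through [ln rho] onto the circle of radius rho, where the
   numerator of q is at most [2 * M]. *)
apply: (@periodic_limit_le q v d _ (ln rho)%:C) => //.
- have := pi_gt0 R => pi0; apply/eqP => /(congr1 (@complex.Im R)) /=; lra.
- have cexpv w : cexp (w + v) = cexp w.
    rewrite cexpD (_ : cexp v = 1) ?mulr1// /v /cexp /= expR0.
    by rewrite cosDpi sinDpi cospi sinpi !opprK oppr0 mulr1 mulr0.
  by move=> w; rewrite /q !add0r !mulN1r !cexpN cexpv.
- move=> t; rewrite nq Re_v lnK ?posrE// ler_pM2r ?invr_gt0//.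
  have := le_normcD (f (a + cexp ((ln rho)%:C + t%:C * v))) (- f a); rewrite normcN.
  have : normc (f a) <= M by apply: fM; rewrite subrr ComplexField.Normc.normc0 ltW.
  suff : normc (f (a + cexp ((ln rho)%:C + t%:C * v))) <= M by lra.
  by apply: fM; rewrite addrC addKr normc_cexp Re_v lnK ?posrE.
- move=> e /fd[r r0 fr]; exists (ln (r / 2))%:C => t.
  have r20 : 0 < r / 2 by lra.
  set w := _ + _ * v.
  have nw : normc (cexp w) = r / 2 by rewrite normc_cexp Re_v lnK ?posrE.
  have : normc (f (a + cexp w) - f a - d * cexp w) <= e * (r / 2).
    by rewrite -nw; apply: fr; rewrite nw; lra.
  rewrite (_ : q w - d = (f (a + cexp w) - f a - d * cexp w) / cexp w).
    by rewrite ComplexField.Normc.normcM ComplexField.Normc.normcV nw ler_pdivrMr.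
  by rewrite /q mul1r add0r mulN1r cexpN [RHS]mulrBl mulfK ?cexp_neq0.
Qed.

(** A mean value inequality by bisection of the segment from a to z. Discs of radius [rho / 2]
    around its points stay in the large disc, so Cauchy bounds the derivative by [4 * M / rho]; the
    gap up to L absorbs the differentiation error. *)
Lemma holo_lipschitz f a z (rho M L : R) : holo f -> 0 < rho ->
  (forall w, normc (w - a) <= rho -> normc (f w) <= M) ->
  4 * M / rho < L -> normc (z - a) <= rho / 2 ->
  normc (f z - f a) <= L * normc (z - a).
Proof.
move=> hf rho0 fM ML za; set k := z - a in za *; have k0 := normc_ge0 k.
(* The coordinate t is a dummy: the square bisection is used on an interval. *)
pose P (s t r : R) :=
  normc (f (a + (s + r)%:C * k) - f (a + s%:C * k)) <= L * (r * normc k).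
suff : P 0 0 1 by rewrite /P add0r !mul1r mul0r addr0 /k [a + _]addrC subrK.
apply: (square_bisection (P := P)); last exact: ltr01.
- move=> s t r; rewrite /P -addrA -splitr => H1 H2 _ _.
  set m := f (a + (s + r / 2)%:C * k) in H1 H2.
  rewrite -(subrKA m).
  by apply: le_trans (le_normcD _ _) _; lra.
- move=> s t s01 _; set b := a + s%:C * k.
  have ba : normc (b - a) <= rho / 2.
    rewrite /b addrC addKr ComplexField.Normc.normcM normcR ger0_norm; last by lra.
    apply: le_trans _ za; rewrite -[leRHS]mul1r ler_wpM2r//; lra.
  have [d bd] := hf b.
  have dM : normc d <= 2 * M / (rho / 2).
    apply: cderiv_le bd _ _ => //; first by lra.
    move=> w wb; apply: fM; have := le_normcD (w - b) (b - a).
    by rewrite addrA subrK; lra.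
  have dE : 2 * M / (rho / 2) = 4 * M / rho by field; rewrite gt_eqF.
  have [|r0 r00 fr] := bd (L - 4 * M / rho); first by lra.
  exists (r0 / (normc k + 1)) => [|s' t' r]; first by rewrite divr_gt0//; lra.
  case/andP=> rpos; rewrite ltr_pdivlMr; last by lra.
  move=> rr ss _; rewrite /P.
  have step (x : R) : `|x| <= r ->
      normc (f (b + x%:C * k) - f b - d * (x%:C * k)) <= (L - 4 * M / rho) * (`|x| * normc k).
    move=> xr; have := fr (x%:C * k).
    rewrite !ComplexField.Normc.normcM normcR; apply.
    apply: le_lt_trans _ rr; nra.
  have e1 : (s' + r)%:C * k = s%:C * k + (s' + r - s)%:C * k.
    by rewrite !(rmorphD, rmorphN); ring.
  have e2 : s'%:C * k = s%:C * k + (s' - s)%:C * k by rewrite !(rmorphD, rmorphN); ring.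
  rewrite e1 e2 !addrA -/b.
  have H1 : `|s' + r - s| <= r by rewrite ler_norml; lra.
  have {}H1 := step _ H1.
  have H2 : `|s' - s| <= r by rewrite ler_norml; lra.
  have {}H2 := step _ H2.
  rewrite ger0_norm in H1; last by lra.
  rewrite ler0_norm in H2; last by lra.
  set f1 := f _ in H1 *; set f2 := f (_ + (s' - s)%:C * k) in H2 *.
  rewrite (_ : f1 - f2 = (f1 - f b - d * ((s' + r - s)%:C * k)) + d * (r%:C * k)
     - (f2 - f b - d * ((s' - s)%:C * k))); last first.
    by rewrite !(rmorphD, rmorphN); ring.
  apply: le_trans (le_normcD _ _) _; rewrite normcN.
  apply: le_trans (lerD (le_normcD _ _) (lexx _)) _.
  rewrite !ComplexField.Normc.normcM normcR (gtr0_norm rpos).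
  have : normc d * (r * normc k) <= 4 * M / rho * (r * normc k).
    by rewrite ler_wpM2r ?mulr_ge0 ?(ltW rpos)// -dE.
  lra.
Qed.

(** * Lower bounds on discs by the Hardy-Littlewood trick *)

Lemma holo_bounded f : holo f ->
  exists B : R, forall x y : R, -1 <= x <= 1 -> -1 <= y <= 1 -> normc (f (x +i* y)) <= B.
Proof.
move=> hf; pose P (s t r : R) := exists B : R, forall x y : R,
  s <= x <= s + r -> t <= y <= t + r -> normc (f (x +i* y)) <= B.
suff [B PB] : P (-1) (-1) 2 by exists B => x y xi yi; apply: PB; lra.
apply: (square_bisection (P := P)); last by [].
- move=> s t r [B1 H1] [B2 H2] [B3 H3] [B4 H4].
  exists (Num.max (Num.max B1 B2) (Num.max B3 B4)) => x y xi yi.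
  rewrite !le_max; have [xs|xs] := leP x (s + r / 2); have [yt|yt] := leP y (t + r / 2).
  + by rewrite H1//; lra.
  + by rewrite H3 ?orbT//; lra.
  + by rewrite H2 ?orbT//; lra.
  + by rewrite H4 ?orbT//; lra.
- move=> s t _ _; have [d] := hf (s +i* t).
  move=> /cderiv_lipschitz[r0 r00 fr]; exists (r0 / 2); first by lra.
  move=> s' t' r /andP[rpos rr] ss tt.
  exists (normc (f (s +i* t)) + (normc d + 1) * r0) => x y xi yi.
  have hE : x +i* y = (s +i* t) + ((x - s) +i* (y - t)).
    by apply/eqP; rewrite eq_complex /=; apply/andP; split; apply/eqP; ring.
  have hr : normc ((x - s) +i* (y - t)) < r0.
    apply: le_lt_trans (normc_leD _ _) _.
    have : `|x - s| <= r by rewrite ler_norml; lra.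
    have : `|y - t| <= r by rewrite ler_norml; lra.
    lra.
  have := fr _ hr; rewrite -hE.
  have := normc_le_add (f (x +i* y)) (f (s +i* t)).
  have : (normc d + 1) * normc ((x - s) +i* (y - t)) <= (normc d + 1) * r0.
    by apply: ler_wpM2l; [have := normc_ge0 d; lra|exact: ltW].
  lra.
Qed.

(* Hardy-Littlewood trick: at a near-maximum z of |f| (1 - |z|)^(m+1) over the unit
   disc, |f| is at most 2^(m+2) |f z| on the disc of radius (1 - |z|) / 2 around z,
   so Cauchy's estimate keeps it above |f z| / 2 on a proportional smaller disc. *)
Lemma holo_large_on_disc (m : nat) : exists2 k : R, 0 < k <= 1 &
  forall f, holo f -> exists z (r : R), [/\ 0 < r <= 1, normc z <= 1 - r &
    forall w, normc (w - z) <= k * r -> k * normc (f 0) <= r ^+ m.+1 * normc (f w)].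
Proof.
pose K : R := 2 ^+ m.+2; have K0 : 1 <= K by rewrite exprn_ege1// ler1n.
(* Over the distance [r / (20 * K)], the Lipschitz constant [5 * (K * normc (f z)) / r] lets f vary
   by at most [normc (f z) / 4]. *)
exists (20 * K)^-1 => [|f hf].
  by rewrite invr_gt0 invf_le1; lra.
(* If [f 0] vanishes the bound is trivial; otherwise the supremum of [psi] is positive and is
   attained up to a factor 2. *)
have [f0|/normc_gt0 f0] := eqVneq (f 0) 0.
  exists 0, 1; split; first by rewrite ltr01 lexx.
    by rewrite ComplexField.Normc.normc0 subrr.
  by move=> w _; rewrite f0 ComplexField.Normc.normc0 mulr0 expr1n mul1r normc_ge0.
pose psi z := normc (f z) * (1 - normc z) ^+ m.+1.
pose A := [set psi z | z in [set z | normc z <= 1]]%classic.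
have psi0 : psi 0 = normc (f 0).
  by rewrite /psi ComplexField.Normc.normc0 subr0 expr1n mulr1.
have N01 : normc (0 : R[i]) <= 1 by rewrite ComplexField.Normc.normc0 ler01.
have A0 : A (psi 0) by exists 0.
have [B fB] := holo_bounded hf.
have ubA : has_ubound A.
  exists B => _ [z /= z1 <-].
  have zB : normc (f z) <= B.
    case: z z1 => x y xy; apply: fB; rewrite -ler_norml; apply: le_trans xy.
      exact: normc_Re (x +i* y).
    exact: normc_Im (x +i* y).
  apply: le_trans zB; rewrite ler_piMr ?normc_ge0// exprn_ile1//; first by lra.
  by have := normc_ge0 z; lra.
have supA : has_sup A by split=> //; exists (psi 0).
have S0 : normc (f 0) <= sup A by rewrite -psi0; exact: ub_le_sup.
have [|_ [z /= z1 <-] zS] := sup_adherent (_ : 0 < sup A / 2) supA; first by lra.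
have psiz : sup A <= 2 * psi z by lra.
have z_lt1 : normc z < 1.
  rewrite lt_neqAle z1 andbT; apply/eqP => zE.
  by move: psiz; rewrite /psi zE subrr expr0n mulr0; lra.
pose r := (1 - normc z) / 2.
have r0 : 0 < r by rewrite /r; lra.
have zr : 1 - normc z = 2 * r by rewrite /r; field.
have fz0 : 0 < normc (f z).
  rewrite lt_neqAle normc_ge0 andbT eq_sym; apply/eqP => fz.
  by move: psiz; rewrite /psi fz mul0r; lra.
(* Here [1 - normc w] is at least r while [1 - normc z] is [2 * r]: this costs 2^(m+1), and
   near-maximality another 2. *)
have fle w : normc (w - z) <= r -> normc (f w) <= K * normc (f z).
  move=> wz; have := normc_le_add w z => wD.
  have w1 : normc w <= 1 by lra.
  have Aw : psi w <= sup A by apply: ub_le_sup => //; exists w.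
  have : normc (f w) * r ^+ m.+1 <= psi w.
    rewrite ler_wpM2l ?normc_ge0// lerXn2r ?nnegrE//; try lra.
  have pz : psi z = normc (f z) * 2 ^+ m.+1 * r ^+ m.+1 by rewrite /psi zr exprMn mulrA.
  move=> pw; rewrite -(ler_pM2r (exprn_gt0 m.+1 r0)) /K [2 ^+ m.+2]exprS; lra.
exists z, r; split; [by have := normc_ge0 z; lra|by lra|].
move=> w wz.
have wz' : normc (w - z) <= r / 2.
  apply: le_trans wz _; rewrite mulrC ler_wpM2l ?(ltW r0)//.
  by rewrite lef_pV2 ?posrE//; lra.
have L : 4 * (K * normc (f z)) / r < 5 * (K * normc (f z)) / r.
  rewrite ltr_pM2r ?invr_gt0// ltr_pM2r//; first by lra.
  by rewrite mulr_gt0//; lra.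
have := holo_lipschitz hf r0 fle L wz' => D.
have : normc (f z) <= 2 * normc (f w).
  have : 5 * (K * normc (f z)) / r * normc (w - z) <= normc (f z) / 2.
    apply: (@le_trans _ _ (5 * (K * normc (f z)) / r * ((20 * K)^-1 * r))).
      apply: ler_wpM2l => //; apply: divr_ge0 (ltW r0); apply: mulr_ge0 => //.
      by apply: mulr_ge0 (normc_ge0 _); lra.
    have -> : 5 * (K * normc (f z)) / r * ((20 * K)^-1 * r) = normc (f z) / 4.
      by field; rewrite !gt_eqF//; lra.
    by lra.
  have := normc_le_add (f z) (f w); rewrite (normcB (f z)); lra.
move=> fzw; rewrite ler_pdivrMl; last by lra.
have psizE : psi z = r ^+ m.+1 * (2 ^+ m.+1 * normc (f z)).
  by rewrite /psi zr exprMn; ring.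
have : r ^+ m.+1 * (2 ^+ m.+1 * normc (f z)) <= r ^+ m.+1 * (2 ^+ m.+1 * (2 * normc (f w))).
  by rewrite !ler_wpM2l// exprn_ge0// ltW.
have : 0 <= r ^+ m.+1 * (2 ^+ m.+1 * normc (f w)).
  by rewrite !mulr_ge0 ?exprn_ge0 ?normc_ge0// ltW.
rewrite /K [2 ^+ m.+2]exprS; lra.
Qed.

(** * Integral comparison *)

(** The integral of a nonnegative function is a supremum over the simple functions below it, and a
    larger integrand has more of them. *)
Lemma ge0_le_integralT (dsp : measure_display) (T : measurableType dsp)
    (mu : {measure set T -> \bar R}) (F G : T -> \bar R) :
  (forall x, 0 <= F x)%E -> (forall x, F x <= G x)%E ->
  (\int[mu]_x F x <= \int[mu]_x G x)%E.
Proof.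
move=> F0 FG; rewrite !ge0_integralTE//; last by move=> x; exact: le_trans (FG x).
by apply: ereal_sup_le => _ [s sF <-]; exists s => // x; exact: le_trans (FG x).
Qed.

Lemma integral_square_ge (F : R * R -> R) (x y s b : R) : 0 < s -> 0 <= b ->
  (forall t, 0 <= F t) ->
  (forall t, `|t.1 - x| <= s -> `|t.2 - y| <= s -> b <= F t) ->
  ((b * (2 * s) ^+ 2)%:E <= \int[@area R]_t (F t)%:E)%E.
Proof.
move=> s0 b0 F0 Fb.
pose I (c : R) := `[c - s, c + s]%classic.
pose S := (I x `*` I y)%classic.
have mI c : measurable (I c) by exact: measurable_itv.
have mS : measurable S by exact: measurableX.
have lI c : lebesgue_measure (I c) = (2 * s)%:E.
  rewrite /I lebesgue_measure_itv /= lte_fin ifT; last by lra.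
  by rewrite -EFinB; congr (_%:E); ring.
have -> : (b * (2 * s) ^+ 2)%:E = (\int[@area R]_t (b%:E * (\1_S t)%:E))%E.
  rewrite /area ge0_integralZl//=; last first.
    by apply/measurable_realfun.measurable_EFinP; exact: measurable_realfun.measurable_indic.
  rewrite integral_indic// setIT.
  have areaS := etrans (product_measure1E (@lebesgue_measure R) (@lebesgue_measure R)
    (mI x) (mI y)) (congr2 mule (lI x) (lI y)).
  by rewrite [X in (_ * X)%E](_ : _ = ((2 * s) ^+ 2)%:E)//; exact: areaS.
rewrite /area; apply: ge0_le_integralT => z; rewrite -EFinM lee_fin indicE.
  by rewrite mulr_ge0.
case: (boolP (z \in S)) => [|_]; last by rewrite mulr0.
rewrite mulr1 inE => -[]; rewrite /I /= !in_itv /= => xI yI.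
by apply: Fb; rewrite ler_norml; lra.
Qed.

(** * The pointwise estimate in the Fock space *)

Variables (alpha p : R).
Hypotheses (alpha_gt0 : 0 < alpha) (p_gt0 : 0 < p).

(** The reciprocal of the Gaussian factor in [fock_weighted]. *)
Let W (w : R * R) := expR (alpha * normc (cplx w) ^+ 2 / 2).

Lemma fock_weighted_ge0 f (w : R * R) : 0 <= fock_weighted alpha f w.
Proof. by rewrite mulr_ge0 ?normc_ge0 ?expR_ge0. Qed.

Lemma normc_cplx_sqr (w : R * R) : normc (cplx w) ^+ 2 = w.1 ^+ 2 + w.2 ^+ 2.
Proof. by rewrite /= sqr_sqrtr// addr_ge0 ?sqr_ge0. Qed.

(** The exponential twist accounts for the cross term 2 Re(conj(w) z) of |w + z|^2. *)
Lemma fock_translate f (w z : R * R) :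
  normc (f (cplx w + 1 * cplx z) * cexp (0 + - (alpha%:C * (cplx w)^*) * cplx z)) =
  fock_weighted alpha f (w + z) * (W w * W z).
Proof.
rewrite ComplexField.Normc.normcM normc_cexp /fock_weighted mul1r.
rewrite -[cplx w + cplx z]/(cplx (w + z)).
rewrite -mulrA; congr (_ * _); rewrite /W -!expRD !normc_cplx_sqr; congr expR.
by case: w z => [a b] [c d] /=; field.
Qed.

(* Applying holo_large_on_disc to z |-> f (w + z) exp (- alpha * conj w * z), whose
   modulus is, up to constants, the weighted modulus of f at w + z. *)
Lemma fock_weighted_le_integral : exists2 c : R, 0 < c &
  forall f, holo f -> forall w : R * R,
    ((c * fock_weighted alpha f w `^ p)%:E <= fock_integral p alpha f)%E.
Proof.
pose m := Num.bound (2 / p).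
have mp : 2 <= m.+1%:R * p.
  rewrite -ler_pdivrMr//; apply: (@le_trans _ _ m%:R); last by rewrite ler_nat.
  by apply/ltW/archi_boundP; rewrite divr_ge0// ltW.
have [k /andP[k0 k1] kP] := holo_large_on_disc m.
(* The factor pays for [W u], which is at most [expR (alpha / 2)] on the unit disc. *)
pose k' := k * expR (- (alpha / 2)).
have k'0 : 0 < k' by rewrite mulr_gt0 ?expR_gt0.
exists (k ^+ 2 * k' `^ p) => [|f hf w]; first by rewrite mulr_gt0 ?exprn_gt0 ?powR_gt0.
pose g z := f (cplx w + 1 * z) * cexp (0 + - (alpha%:C * (cplx w)^*) * z).
have [|z [r [/andP[r0 r1] zr zP]]] := kP g.
  apply: holoM; first by apply: (holo_comp hf); exact: holo_affine.
  by apply: (holo_comp holo_cexp); exact: holo_affine.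
have gE (z' : R * R) : normc (g (cplx z')) = fock_weighted alpha f (w + z') * (W w * W z').
  exact: fock_translate.
have W0 : W 0 = 1.
  by rewrite /W normc_cplx_sqr /= expr0n addr0 mulr0 mul0r expR0.
have g0 : normc (g 0) = fock_weighted alpha f w * W w.
  by rewrite -[0]/(cplx 0) gE W0 addr0 mulr1.
have lower (u : R * R) : normc (cplx u - z) <= k * r ->
    k' * fock_weighted alpha f w <= r ^+ m.+1 * fock_weighted alpha f (w + u).
  move=> uz; have := zP _ uz; rewrite g0 gE.
  have u1 : normc (cplx u) <= 1.
    have := normc_le_add (cplx u) z; have : k * r <= r by rewrite ler_piMl// ltW.
    lra.
  have Wu : W u <= expR (alpha / 2).
    rewrite /W ler_expR ler_pM2r// ler_piMr ?(ltW alpha_gt0)//.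
    by rewrite exprn_ile1 ?normc_ge0.
  have cancel (A B x y E : R) : 0 < x -> 0 < E -> 0 <= B -> y <= E ->
      k * (A * x) <= B * (y * x) -> k / E * A <= B.
    move=> x0 E0 B0 yE; rewrite !mulrA ler_pM2r// => H.
    by rewrite mulrAC ler_pdivrMr//; apply: le_trans H _; rewrite ler_wpM2l.
  rewrite (mulrC (W w)) [leRHS]mulrA => H; rewrite /k' expRN.
  apply: (cancel _ _ (W w) (W u)) => //; try exact: expR_gt0.
  by rewrite mulr_ge0 ?exprn_ge0 ?fock_weighted_ge0// ltW.
(* The claimed bound as height times area of a square of side [k * r]; the height is divided by
   [r ^+ 2], which (m+1) p >= 2 compensates. *)
have pe : k ^+ 2 * k' `^ p * fock_weighted alpha f w `^ p =
    (k' * fock_weighted alpha f w) `^ p / r ^+ 2 * (2 * (k * r / 2)) ^+ 2.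
  rewrite powRM ?fock_weighted_ge0 ?(ltW k'0)//.
  by move: (_ `^ p) (_ `^ p) => a b; field; rewrite gt_eqF.
rewrite pe /fock_integral.
apply: (@integral_square_ge _ (w.1 + Re z) (w.2 + Im z)).
- by rewrite divr_gt0// mulr_gt0.
- by rewrite divr_ge0 ?powR_ge0// exprn_ge0// ltW.
- by move=> u; exact: powR_ge0.
move=> u u1 u2.
have := lower (u - w); rewrite (addrC w) subrK => H.
have {}H : k' * fock_weighted alpha f w <= r ^+ m.+1 * fock_weighted alpha f u.
  apply: H; have -> : cplx (u - w) - z = (u.1 - (w.1 + Re z)) +i* (u.2 - (w.2 + Im z)).
    apply/eqP; rewrite eq_complex; case: (z) => x y /=.
    by apply/andP; split; apply/eqP; ring.
  by apply: le_trans (normc_leD _ _) _; rewrite [leRHS]splitr lerD.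
rewrite ler_pdivrMr ?exprn_gt0//.
have r_le : (r ^+ m.+1) `^ p <= r ^+ 2.
  rewrite -powR_mulrn ?(ltW r0)// -powRrM -(subrK 2 (_ * p)) addrC powRD; last first.
    by rewrite (gt_eqF r0) implybT.
  rewrite powR_mulrn ?(ltW r0)// ler_piMr ?exprn_ge0 ?(ltW r0)//.
  apply: (@le_trans _ _ (1 `^ (m.+1%:R * p - 2))); last by rewrite powR1.
  by apply: ge0_ler_powR; rewrite ?nnegrE ?(ltW r0)// subr_ge0.
apply: (@le_trans _ _ ((r ^+ m.+1 * fock_weighted alpha f u) `^ p)).
  apply: ge0_ler_powR H; rewrite ?nnegrE ?(ltW p_gt0)//.
    exact: mulr_ge0 (ltW k'0) (fock_weighted_ge0 _ _).
  by apply: mulr_ge0 (fock_weighted_ge0 _ _); rewrite exprn_ge0// ltW.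
rewrite powRM ?fock_weighted_ge0 ?exprn_ge0 ?(ltW r0)// mulrC ler_wpM2l ?powR_ge0//.
Qed.

(** The p-th root of the integral bound, with the normalising factor of the norm absorbed into the
    constant. *)
Lemma fock_weighted_le_norm : exists2 C : R, 0 < C &
  forall f, in_Fock p alpha f -> forall w : R * R,
    fock_weighted alpha f w <= C * fock_norm p alpha f.
Proof.
have [c c0 cP] := fock_weighted_le_integral.
have : 0 < p * alpha / (2 * pi) by rewrite divr_gt0// mulr_gt0// pi_gt0.
rewrite /fock_norm; move: (p * alpha / (2 * pi)) => a a0.
exists ((c * a)^-1 `^ p^-1) => [|f [fe fI] w].
  by rewrite powR_gt0// invr_gt0 mulr_gt0.
have I0 : (0 <= fock_integral p alpha f)%E.
  by apply: integral_ge0 => z _; rewrite lee_fin powR_ge0.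
have := cP f (entire_holo fe) w.
have Ifin : fock_integral p alpha f \is a fin_num by rewrite ge0_fin_numE.
rewrite -(fineK Ifin) lee_fin mulrC -ler_pdivlMr// => H.
have I0' : 0 <= fine (fock_integral p alpha f) by exact: fine_ge0.
rewrite -powRM ?invr_ge0 ?mulr_ge0// ?(ltW c0) ?(ltW a0)//.
have -> : (c * a)^-1 * (a * fine (fock_integral p alpha f))
    = fine (fock_integral p alpha f) / c.
  by field; rewrite !gt_eqF.
rewrite -[leLHS]powRr1 ?fock_weighted_ge0// -(divff (lt0r_neq0 p_gt0)) powRrM.
by apply: ge0_ler_powR; rewrite ?nnegrE ?powR_ge0 ?invr_ge0 ?(ltW p_gt0)// divr_ge0// ltW.
Qed.

End FockPointwise.

(** * From the pointwise estimate to Fock-Carleson measures *)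

Theorem theorem3p2 (R : realType) (alpha p : R) (halpha : 0 < alpha) (hp : 0 < p)
  (mu : {finite_measure set (R * R)%type -> \bar R}) :
  FC_measure_inf p alpha mu <-> (forall q : R, 1 <= q -> FC_measure_q p q alpha mu).
Proof.
have [C C0 fC] := fock_weighted_le_norm halpha hp.
split=> _; last first.
  by exists C => // f /fC fw; apply: ess_sup_ler => t; rewrite lee_fin.
move=> q q1; have q0 : 0 < q by exact: lt_le_trans q1.
have muT : mu setT \is a fin_num by exact: fin_num_measure.
set M := fine (mu setT); have M0 : 0 <= M by exact: fine_ge0.
(* The mass M is replaced by [M + 1] to keep the constant positive for the zero measure. *)
exists (C * (M + 1) `^ q^-1) => [|f /fC fw].
  by rewrite mulr_gt0// powR_gt0// ltr_wpDl.
set K := C * fock_norm p alpha f in fw *.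
have K0 : 0 <= K by rewrite mulr_ge0 ?powR_ge0// ltW.
have int_le : (\int[mu]_z ((fock_weighted alpha f z) `^ q)%:E <= (K `^ q * M)%:E)%E.
  rewrite EFinM /M fineK// -integral_cst//.
  apply: ge0_le_integralT => z; rewrite lee_fin ?powR_ge0//.
  by apply: ge0_ler_powR; rewrite ?nnegrE ?fock_weighted_ge0// ltW.
have int_ge0 : (0 <= \int[mu]_z ((fock_weighted alpha f z) `^ q)%:E)%E.
  by apply: integral_ge0 => z _; rewrite lee_fin powR_ge0.
apply: (@le_trans _ _ ((K `^ q * M)%:E `^ q^-1)%E).
  apply: gt0_ler_poweR => //; first by rewrite invr_ge0 ltW.
  - by rewrite in_itv /= int_ge0 leey.
  - by rewrite in_itv /= leey lee_fin mulr_ge0 ?powR_ge0.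
rewrite poweR_EFin lee_fin powRM ?powR_ge0// -powRrM divff ?gt_eqF// powRr1//.
rewrite [leRHS]mulrAC -/K ler_wpM2l//.
apply: ge0_ler_powR; rewrite ?nnegrE ?addr_ge0 ?lerDl//.
by rewrite invr_ge0 ltW.
Qed.
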